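(* For any $i\ge1$ and any $(t,x,y)\in(0,\infty)\times F_\infty\times F_\infty$, $$\big|p_t^{F_i}(\Phi_i(x),\Phi_i(y))-p_t^{F_{i-1}}(\Phi_{i-1}(x),\Phi_{i-1}(y))\big|\le N_iJ_i\big(1+(J_i^2t)^{-1}\big)e^{-J_i^2t}.$$
   Context: Parameters. $\{j_\ell\}_{\ell\ge0},\{n_\ell\}_{\ell\ge0}$ are integer sequences with $j_0=n_0=1$ and $j_\ell,n_\ell\ge2$ for $\ell\ge1$. Set $J_0=N_0=1$, $J_i=\prod_{\ell=1}^ij_\ell$, $N_i=\prod_{\ell=1}^in_\ell$, $[n_i]=\{1,\dots,n_i\}$, $L_i=\pi/J_i$ for $i\ge1$. Spaces. Let $\vartheta_0=\{0,\pi\}$ and, for $i\ge1$, $\vartheta_i=\{\pi k/J_i: 0<k<2J_i,\ j_i\nmid k\}$; thus $\bigcup_{\ell=0}^i\vartheta_\ell=\{\pi k/J_i:0\le k<2J_i\}$. Let $F_0=\mathbb{R}/2\pi\mathbb{Z}$ (points identified with angles in $[0,2\pi)$), $B_0=\vartheta_0$, $B_1=B_0\cup\vartheta_1$, and inductively for $i\ge1$: $F_i=(F_{i-1}\times[n_i])/\!\sim$, where $(x,w)\sim(x',w')$ iff $x=x'$ and ($w=w'$ or $x\in B_i$), and for $i\ge2$, $B_i=B_{i-1}\cup(\vartheta_i\times[n_1]\times\dots\times[n_{i-1}])\subseteq F_{i-1}$ (the set of points of $F_{i-1}$ whose angle lies in $\bigcup_{\ell\le i}\vartheta_\ell$). $[\eta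 w_1\dots w_i]$ denotes the point of $F_i$ represented by $\eta\in F_0$, $w_\ell\in[n_\ell]$. Let $\phi_i:F_i\to F_{i-1}$ be induced by $(x,w)\mapsto x$. The diamond fractal is $F_\infty=\{(x_i)_{i\ge0}: x_i\in F_i,\ \phi_i(x_i)=x_{i-1}\ \forall i\ge1\}$, with $\Phi_i:F_\infty\to F_i$, $\Phi_i((x_k)_k)=x_i$. Cells. For $i\ge1$ let $\mathcal{A}_i=\big(\bigcup_{\ell=0}^i\vartheta_\ell\big)\times[n_1]\times\dots\times[n_i]$. For $\alpha=(\eta,w_1,\dots,w_i)\in\mathcal{A}_i$ let $\varphi_\alpha:[0,L_i]\to F_i$, $\varphi_\alpha(\theta)=[(\eta+\theta)w_1\dots w_i]$, with image the $i$-cell $I_\alpha$. Two $i$-cells $I_\alpha,I_\beta$ are in the same bundle if $\alpha,\beta$ agree in all but possibly their last entry. For $x\in F_i$, $(\theta_x,\alpha_x)\in[0,L_i)\times\mathcal{A}_i$ is a pair with $\varphi_{\alpha_x}(\theta_x)=x$ ($\alpha_x$ smallest in lexicographic order if not unique). Heat kernels. $p_t^{F_0}(\theta_1,\theta_2)=\frac1{2\pi}+\frac1\pi\sum_{k\ge1}e^{-k^2t}\cos(k(\theta_2-\theta_1))$ and $p_t^{[0,L_i]_D}(\theta_1,\theta_2)=\frac2{L_i}\sum_{k\ge1}e^{-k^2\pi^2t/L_i^2}\sin(k\pi\theta_1/L_i)\sin(k\pi\theta_2/L_i)$. For $i\ge1$ the heat kernel on $F_i$ is, recursively, $p_t^{F_i}(x,y)=p_t^{F_{i-1}}(\phi_i(x),\phi_i(y))+c_i(x,y)N_{i-1}\,p_t^{[0,L_i]_D}(\theta_x,\theta_y)$,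 where $c_i(x,y)=0$ if $I_{\alpha_x},I_{\alpha_y}$ are not in the same bundle, $c_i(x,y)=-1$ if they are in the same bundle but $\alpha_x\neq\alpha_y$, and $c_i(x,y)=n_i-1$ if $\alpha_x=\alpha_y$. *)

(* Defs.v *)
From HB Require Import structures.
From mathcomp Require Import all_boot all_order all_algebra generic_quotient.
From mathcomp Require Import all_classical all_reals all_analysis.

Set Implicit Arguments.
Unset Strict Implicit.
Unset Printing Implicit Defensive.

Import Order.TTheory GRing.Theory Num.Theory.
Import numFieldNormedType.Exports.
Local Open Scope classical_set_scope.
Local Open Scope ring_scope.

Definition Jprod (j : nat -> nat) (i : nat) : nat := (\prod_(1 <= l < i.+1) j l)%N.
Definition Nprod (n : nat -> nat) (i : nat) : nat := (\prod_(1 <= l < i.+1) n l)%N.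
Definition Len (R : realType) (j : nat -> nat) (i : nat) : R := pi / (Jprod j i)%:R.

Definition vartheta (R : realType) (j : nat -> nat) (i : nat) : set R :=
  if i is 0%N then [set 0; pi] else
  [set pi * k%:R / (Jprod j i)%:R | k in
    [set k : nat | (0 < k < 2 * Jprod j i)%N /\ ~~ (j i %| k)%N]].

Definition angles (R : realType) (j : nat -> nat) (i : nat) : set R :=
  \bigcup_(l in [set l | (l <= i)%N]) vartheta j l.

(* R / 2 pi Z, through its fundamental domain; [circle_of] is the projection. *)
Definition circle (R : realType) := {x : R | 0 <= x < 2 * pi}.

Fact circle_of_subproof (R : realType) (x : R) :
  0 <= x - 2 * pi * (Num.floor (x / (2 * pi)))%:~R < 2 * pi.
Proof.
have p0 : 0 < 2 * pi :> R by rewrite mulr_gt0 ?pi_gt0.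
have e : x = 2 * pi * (x / (2 * pi)) by rewrite mulrC divfK ?gt_eqF.
have -> : x - 2 * pi * (Num.floor (x / (2 * pi)))%:~R =
    2 * pi * (x / (2 * pi) - (Num.floor (x / (2 * pi)))%:~R).
  by rewrite mulrBr -e.
rewrite pmulr_rge0// subr_ge0 floor_le /= gtr_pMr//.
by rewrite ltrBlDl -intrD1 floorD1_gt.
Qed.

Definition circle_of (R : realType) (x : R) : circle R :=
  exist (fun a : R => is_true (0 <= a < 2 * pi)) _ (circle_of_subproof x).

Fact circle_ofP (R : realType) (x y : R) :
  circle_of x = circle_of y <-> exists k : int, x = y + 2 * pi * k%:~R.
Proof.
have p0 : 2 * pi != 0 :> R by rewrite gt_eqF// mulr_gt0 ?pi_gt0.
split=> [/(congr1 val)/= e|[k ->]]; last first.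
  have e : (y + 2 * pi * k%:~R) / (2 * pi) = y / (2 * pi) + k%:~R.
    by rewrite mulrDl [X in _ + X]mulrAC divff// mul1r.
  apply: val_inj => /=; rewrite e floorDrz ?intr_int// intrKfloor intrD [X in _ - X = _]mulrDr opprD.
  by rewrite addrACA subrr addr0.
exists (Num.floor (x / (2 * pi)) - Num.floor (y / (2 * pi))).
have e1 : forall a b c d : R, a - b = c - d -> a = c + (b - d).
  by move=> a b c d /eqP; rewrite subr_eq => /eqP ->; rewrite -addrA [- d + b]addrC.
by rewrite rmorphB mulrBr; apply: e1.
Qed.

(* A space F_i of the tower, together with the angle map F_i -> F_0. *)
Record level (R : realType) := Level { pts : choiceType; angle : pts -> circle R }.

(* One step of the tower: X is F_{i-1}, m is n_i, and [glued] is F_i. *)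
Section Glue.
Variables (R : realType) (j : nat -> nat) (i m : nat) (X : level R).

(* B_i: the points of F_{i-1} whose angle is \pi k / J_i for some k. *)
Definition branch_set : set (pts X) := [set x | angles j i (val (angle x))].

Definition glue : rel (pts X * 'I_m) :=
  fun p q => (p.1 == q.1) && ((p.2 == q.2) || (p.1 \in branch_set)).

Fact glue_refl : reflexive glue.
Proof. by move=> p; rewrite /glue !eqxx. Qed.

Fact glue_sym : symmetric glue.
Proof.
move=> [x w] [y v]; rewrite /glue /= [v == w]eq_sym [y == x]eq_sym.
by have [->|] := eqVneq x y.
Qed.

Fact glue_trans : transitive glue.
Proof.
move=> [y v] [x w] [z u]; rewrite /glue /= => /andP[/eqP -> +] /andP[/eqP <- +].
rewrite eqxx /=; case: (y \in branch_set); rewrite ?orbT// !orbF.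
by move=> /eqP -> /eqP ->.
Qed.

Canonical glue_equiv := EquivRel glue glue_refl glue_sym glue_trans.

Definition glued : choiceType := {eq_quot glue_equiv}%qT.

(* The map induced by (x, w) |-> x; that it does not depend on the chosen
   representative is [phi_cls]. *)
Definition glued_proj (q : glued) : pts X := (repr q).1.

Definition next_level : level R := Level (fun q : glued => angle (glued_proj q)).

End Glue.

Fixpoint stage (R : realType) (j n : nat -> nat) (i : nat) : level R :=
  if i is k.+1 then next_level j k.+1 (n k.+1) (stage R j n k)
  else Level (fun a : circle R => a).

Definition Flevel (R : realType) (j n : nat -> nat) (i : nat) : choiceType := pts (stage R j n i).

Definition phi (R : realType) (j n : nat -> nat) (i : nat) : Flevel R j n i.+1 -> Flevel R j n i :=
  @glued_proj R j i.+1 (n i.+1) (stage R j n i).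

(* The set {1, ..., n_i} is encoded, in the same order, as 'I_(n i). *)
Definition cls (R : realType) (j n : nat -> nat) (i : nat)
    (x : Flevel R j n i) (w : 'I_(n i.+1)) : Flevel R j n i.+1 :=
  \pi_(glued j i.+1 (n i.+1) (stage R j n i))%qT (x, w).

Fact clsP (R : realType) (j n : nat -> nat) (i : nat)
    (x x' : Flevel R j n i) (w w' : 'I_(n i.+1)) :
  cls x w = cls x' w' <-> x = x' /\ (w = w' \/ angles j i.+1 (val (angle x))).
Proof.
split=> [/eqmodP/=|[<- h]].
  rewrite /glue/= => /andP[/eqP <- /orP[/eqP ->|]]; first by split=> //; left.
  by rewrite inE => h; split=> //; right.
apply/eqmodP; rewrite /= /glue/= eqxx/=; case: h => [->|h]; rewrite ?eqxx//.
by apply/orP; right; rewrite inE.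
Qed.

Fact phi_cls (R : realType) (j n : nat -> nat) (i : nat)
    (x : Flevel R j n i) (w : 'I_(n i.+1)) : phi (cls x w) = x.
Proof.
rewrite /phi /glued_proj /cls.
case: piP => -[y v] /eqmodP /=; by rewrite /glue /= => /andP[/eqP -> _].
Qed.

Definition Finf (R : realType) (j n : nat -> nat) : Type :=
  {x : forall i, Flevel R j n i | forall i, phi (x i.+1) = x i}.

Definition Phi (R : realType) (j n : nat -> nat) (i : nat) (x : Finf R j n) : Flevel R j n i :=
  sval x i.

(* (w_1, ..., w_i) as nested pairs ((tt, w_1), ..., w_i). *)
Fixpoint word (n : nat -> nat) (i : nat) : finType :=
  if i is k.+1 then (word n k * 'I_(n k.+1))%type else unit.

Fixpoint point (R : realType) (j n : nat -> nat) (i : nat) (a : circle R) :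
    word n i -> Flevel R j n i :=
  match i with
  | 0 => fun=> a
  | k.+1 => fun w => cls (point j a w.1) w.2
  end.

(* The condition that the first entry lies in [angles j i], which defines the
   index set A_i, is imposed in [represents]. *)
Definition address (R : realType) (n : nat -> nat) (i : nat) : Type := (R * word n i)%type.

Definition cell_map (R : realType) (j n : nat -> nat) (i : nat)
    (al : address R n i) (theta : R) : Flevel R j n i :=
  point j (circle_of (al.1 + theta)) al.2.

Definition same_bundle (R : realType) (n : nat -> nat) (i : nat)
    (al be : address R n i.+1) : bool :=
  (al.1 == be.1) && (al.2.1 == be.2.1).

Fixpoint word_lt (n : nat -> nat) (i : nat) : rel (word n i) :=
  match i with
  | 0 => fun _ _ => false
  | k.+1 => fun u v => word_lt u.1 v.1 || (u.1 == v.1) && (u.2 < v.2)%N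
  end.

Definition address_le (R : realType) (n : nat -> nat) (i : nat) (al be : address R n i) : bool :=
  (al.1 < be.1) || (al.1 == be.1) && ((al.2 == be.2) || word_lt al.2 be.2).

Definition represents (R : realType) (j n : nat -> nat) (i : nat)
    (x : Flevel R j n i) (p : R * address R n i) : Prop :=
  [/\ 0 <= p.1 < Len R j i, p.2.1 \in angles j i & cell_map j p.2 p.1 = x].

Definition is_coord (R : realType) (j n : nat -> nat) (i : nat)
    (x : Flevel R j n i) (p : R * address R n i) : Prop :=
  represents x p /\ forall q, represents x q -> address_le p.2 q.2.

Fixpoint some_word (R : realType) (j n : nat -> nat) (i : nat) : Flevel R j n i -> word n i :=
  match i with
  | 0 => fun=> tt
  | k.+1 => fun x : Flevel R j n k.+1 => let p := repr (x : glued _ _ _ (stage R j n k)) in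
      (some_word p.1, p.2)
  end.

(* The pair (theta_x, alpha_x).  The default of [xget] is not used as
   soon as the j_l are positive, by [coordP]. *)
Definition coord (R : realType) (j n : nat -> nat) (i : nat) (x : Flevel R j n i) :
    R * address R n i :=
  xget (0, (0, some_word x)) [set p | is_coord x p].

Fact anglesE (R : realType) (j : nat -> nat) (i : nat) :
  (forall l, (0 < l)%N -> (0 < j l)%N) ->
  angles j i = [set pi * k%:R / (Jprod j i)%:R | k in [set k | (k < 2 * Jprod j i)%N]] :> set R.
Proof.
move=> j0.
have JS l : Jprod j l.+1 = (Jprod j l * j l.+1)%N by rewrite /Jprod big_nat_recr.
have J0 l : (0 < Jprod j l)%N.
  by elim: l => [|l IH]; [rewrite /Jprod big_geq | rewrite JS muln_gt0 IH j0].
have up l k : pi * (k * j l.+1)%:R / (Jprod j l.+1)%:R = pi * k%:R / (Jprod j l)%:R :> R.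
  by rewrite JS !natrM mulrA -mulf_div divff ?mulr1// pnatr_eq0 -lt0n j0.
elim: i => [|i IH].
  have -> : angles j 0 = [set 0; pi] :> set R.
    apply/seteqP; split=> [x [l /= + h]|x h]; last by exists 0%N.
    by rewrite leqn0 => /eqP l0; move: h; rewrite l0 => h; exact: h.
  have -> : Jprod j 0 = 1%N by rewrite /Jprod big_geq.
  apply/seteqP; split=> [x [->|->]|x [[|[|k]] //= _ <-]].
  - by exists 0%N => //; rewrite mulr0 mul0r.
  - by exists 1%N => //; rewrite mulr1 divr1.
  - by left; rewrite mulr0 mul0r.
  - by right; rewrite mulr1 divr1.
have -> : angles j i.+1 = angles j i `|` vartheta j i.+1 :> set R.
  apply/seteqP; split=> [x [l /= + h]|x [[l /= li h]|h]].
  - rewrite leq_eqVlt => /orP[/eqP e|li]; first by rewrite e in h; right.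
    by left; exists l.
  - by exists l => //=; exact: leqW.
  - by exists i.+1 => /=.
rewrite IH; apply/seteqP; split=> [x [[k /= ki <-]|[k /= [/andP[_ ki] _] <-]]|x [k /= ki <-]].
- exists (k * j i.+1)%N; last exact: up.
  by rewrite /= JS mulnA ltn_pmul2r ?j0.
- by exists k.
have [/dvdnP[q e]|jk] := boolP (j i.+1 %| k)%N; [left|right].
  exists q; last by rewrite e up.
  by move: ki; rewrite /= JS mulnA e ltn_pmul2r ?j0.
exists k => //=; split=> //; apply/andP; split=> //.
by rewrite lt0n; apply: contra jk => /eqP ->; rewrite dvdn0.
Qed.

Fact word_min (n : nat -> nat) (i : nat) (P : word n i -> Prop) :
  (exists w, P w) -> exists2 w, P w & forall v, P v -> (w == v) || word_lt w v.
Proof.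
elim: i P => [P [[] Pw]|i IH P [[u a] Puw]]; first by exists tt => // -[].
have [|u0 [a0 Pu0] u0min] := IH (fun u => exists a, P (u, a)); first by exists u, a.
pose Q (m : nat) := [exists b : 'I_(n i.+1), (nat_of_ord b == m) && `[< P (u0, b) >]].
have exQ : exists m, Q m.
  by exists (nat_of_ord a0); apply/existsP; exists a0; rewrite eqxx; apply/asboolP.
case: (ex_minnP exQ) => m /existsP[b /andP[/eqP <- /asboolP Pb]] bmin.
exists (u0, b) => // -[v c] Pvc /=.
have /orP[/eqP e|->] := u0min v (ex_intro _ c Pvc); last by rewrite orbT.
rewrite -e eqxx /= in Pvc *; have : Q c.
  by apply/existsP; exists c; rewrite eqxx; apply/asboolP.
move=> /bmin; rewrite leq_eqVlt => /orP[/eqP/val_inj ->|->]; by rewrite ?eqxx ?orbT.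
Qed.

Fact angle_point (R : realType) (j n : nat -> nat) (i : nat) (a : circle R) (w : word n i) :
  angle (point j a w) = a.
Proof. by elim: i w => [//|i IH] w /=; rewrite -/(phi _) phi_cls IH. Qed.

Fact point_some_word (R : realType) (j n : nat -> nat) (i : nat) (x : Flevel R j n i) :
  point j (angle x) (some_word x) = x.
Proof.
elim: i x => [//|i IH] x /=; rewrite /glued_proj IH /cls -surjective_pairing.
exact: reprK.
Qed.

Fact coordP (R : realType) (j n : nat -> nat) (i : nat) (x : Flevel R j n i) :
  (forall l, (0 < l)%N -> (0 < j l)%N) -> is_coord x (coord x).
Proof.
move=> j0.
have J0 l : (0 < Jprod j l)%N.
  elim: l => [|l IH]; first by rewrite /Jprod big_geq.
  by rewrite /Jprod big_nat_recr//= muln_gt0 IH j0.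
suff [p pP] : exists p, is_coord x p by apply: (xgetI _ pP).
have pi0 := pi_gt0 R.
have JR0 : 0 < (Jprod j i)%:R :> R by rewrite ltr0n.
have circK (a : circle R) : circle_of (val a) = a.
  apply: val_inj => /=; have /andP[a0 a2] := valP a.
  have p20 : 0 < 2 * pi :> R by rewrite mulr_gt0.
  have -> : Num.floor (val a / (2 * pi)) = 0.
    by apply: floor_def; rewrite add0r ltr_pdivrMr// mul1r a2 divr_ge0// ltW.
  by rewrite mulr0 subr0.
have idx : {in angles j i, forall e : R, exists2 k, (k < 2 * Jprod j i)%N &
    e = k%:R * Len R j i}.
  move=> e; rewrite anglesE// inE => -[k /= ki <-]; exists k => //.
  by rewrite /Len mulrA [k%:R * pi]mulrC.
have L0 : 0 < Len R j i by rewrite divr_gt0.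
have JL : (2 * Jprod j i)%:R * Len R j i = 2 * pi.
  by rewrite /Len natrM -mulrA [X in 2 * X]mulrC divfK ?gt_eqF.
(* theta and eta are the remainder and quotient of the angle by [Len]. *)
have cell (q : R * address R n i) : represents x q -> exists2 k,
    q.2.1 = k%:R * Len R j i & val (angle x) = k%:R * Len R j i + q.1.
  case: q => th [et w] [/= /andP[th0 thL] /idx[k ki ->] <-]; exists k => //.
  rewrite /cell_map /= angle_point.
  have h : 0 <= k%:R * Len R j i + th < 2 * pi.
    rewrite addr_ge0//=; last by rewrite mulr_ge0// ltW.
    apply: (@lt_le_trans _ _ (k.+1%:R * Len R j i)).
      by rewrite -natr1 mulrDl mul1r ltrD2l.
    apply: (@le_trans _ _ ((2 * Jprod j i)%:R * Len R j i)).
      by rewrite ler_wpM2r ?ler_nat// ltW.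
    by rewrite JL.
  exact: (congr1 val (circK (exist (fun a : R => is_true (0 <= a < 2 * pi)) _ h))).
have /andP[a0 a2] := valP (angle x).
pose k := Num.truncn (val (angle x) / Len R j i).
have /andP[k1 k2] : k%:R <= val (angle x) / Len R j i < k.+1%:R.
  by rewrite truncn_itv// divr_ge0// ltW.
have kJ : (k < 2 * Jprod j i)%N.
  rewrite -(ltr_nat R); apply: le_lt_trans k1 _.
  by rewrite ltr_pdivrMr// JL.
have [|w /= Pw wmin] := @word_min n i (fun w => point j (angle x) w = x).
  by exists (some_word x); exact: point_some_word.
exists (val (angle x) - k%:R * Len R j i, (k%:R * Len R j i, w)); split.
  split => /=.
  - rewrite subr_ge0 -ler_pdivlMr// k1 /= ltrBlDl -[X in _ + X]mul1r -mulrDl.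
    by rewrite natr1 -ltr_pdivrMr.
  - rewrite anglesE// inE; exists k => //=.
    by rewrite /Len mulrA [k%:R * pi]mulrC.
  - by rewrite /cell_map /= addrC subrK circK.
move=> q rq; have [k' ek' ea] := cell q rq.
case: q rq ek' ea => th [et v] [/= /andP[th0 thL] _ cx] ek' ea.
have ekk : k = k'.
  apply/eqP; rewrite /k truncn_eq; last by rewrite divr_ge0// ltW.
  rewrite [\val _](_ : _ = k'%:R * Len R j i + th) // mulrDl mulfK ?gt_eqF// lerDl divr_ge0//=; last exact: ltW.
  by rewrite -natr1 ltrD2l ltr_pdivrMr// mul1r.
rewrite /address_le /= ek' ekk eqxx ltxx /=; apply: wmin.
by rewrite -[RHS]cx /cell_map /= ek' -ea circK.
Qed.

Definition theta (R : realType) (j n : nat -> nat) (i : nat) (x : Flevel R j n i) : R :=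
  (coord x).1.
Definition alpha (R : realType) (j n : nat -> nat) (i : nat) (x : Flevel R j n i) :
  address R n i := (coord x).2.

Definition heat_circle (R : realType) (t theta1 theta2 : R) : R :=
  (2 * pi)^-1 + pi^-1 * limn (fun m : nat =>
    \sum_(1 <= k < m) expR (- (k%:R ^+ 2 * t)) * cos (k%:R * (theta2 - theta1))).

Definition heat_dirichlet (R : realType) (L t theta1 theta2 : R) : R :=
  2 / L * limn (fun m : nat =>
    \sum_(1 <= k < m) expR (- (k%:R ^+ 2 * pi ^+ 2 * t / L ^+ 2))
      * sin (k%:R * pi * theta1 / L) * sin (k%:R * pi * theta2 / L)).

Definition coef (R : realType) (j n : nat -> nat) (k : nat) (x y : Flevel R j n k.+1) : R :=
  if alpha x == alpha y then (n k.+1)%:R - 1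
  else if same_bundle (alpha x) (alpha y) then -1 else 0.

Fixpoint heat (R : realType) (j n : nat -> nat) (i : nat) (t : R) :
    Flevel R j n i -> Flevel R j n i -> R :=
  match i with
  | 0 => fun x y : circle R => heat_circle t (val x) (val y)
  | k.+1 => fun x y =>
      heat t (phi x) (phi y)
      + coef x y * (Nprod n k)%:R * heat_dirichlet (Len R j k.+1) t (theta x) (theta y)
  end.

(* Main.v *)
(* The difference of consecutive heat kernels is a Dirichlet kernel on an
   interval of length L = pi / J, with a coefficient of size at most N.  With
   s = J ^ 2 t its k-th exponential is e ^ (- k ^ 2 s) <= (e ^ (- s)) ^ k, and the
   geometric series q / (1 - q), q = e ^ (- s), is at most (1 + 1 / s) q because
   e ^ s >= 1 + s. *)
Require Import Defs.
From mathcomp Require Import all_boot all_order all_algebra ring lra.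
From mathcomp Require Import all_classical all_reals all_analysis.
Import Order.TTheory GRing.Theory Num.Theory.
Local Open Scope ring_scope.

(** The bounded partial sums of norms are nondecreasing, so the series converges absolutely.
    Convergence has to be proved first: only then is [limn] a genuine limit to which bounds on
    partial sums pass. *)
Lemma norm_lim_sum_le (R : realType) (u : nat -> R) (M : R) :
  (forall m, \sum_(1 <= k < m) `|u k| <= M) ->
  `|limn (fun m => \sum_(1 <= k < m) u k)| <= M.
Proof.
move=> uM.
have cvu : cvgn (fun m => \sum_(1 <= k < m) u k).
  rewrite is_cvg_series_restrict; apply: normed_cvg.
  rewrite /= -(is_cvg_series_restrict 1%N).
  apply: nondecreasing_is_cvgn; last by exists M => _ [m _ <-]; exact: uM.
  by apply: nondecreasing_series => k _ _; exact: normr_ge0.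
have nuM m : `|\sum_(1 <= k < m) u k| <= M.
  exact: le_trans (ler_norm_sum _ _ _) (uM m).
rewrite ler_norml; apply/andP; split.
  by apply: limr_ge => //; apply: nearW => m; have := nuM m; rewrite ler_norml => /andP[].
by apply: limr_le => //; apply: nearW => m; exact: le_trans (ler_norm _) (nuM m).
Qed.

(** The bound is uniform in [m], as [norm_lim_sum_le] requires. Multiplying by [1 - q > 0] makes the
    sum telescope and avoids division. *)
Lemma sum_expR_le (R : realType) (s : R) (m : nat) : 0 < s ->
  \sum_(1 <= k < m) expR (- (k%:R * s)) <= (1 + s^-1) * expR (- s).
Proof.
move=> s0; set q := expR (- s).
have q0 : 0 < q by exact: expR_gt0.
have qs : (1 + s) * q <= 1.
  by rewrite -ler_pdivlMr// mul1r -expRN opprK expR_ge1Dx.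
have qE k : expR (- (k%:R * s)) = q ^+ k by rewrite -mulrN expRM_natl.
have telescope p : (1 - q) * \sum_(1 <= k < p.+1) expR (- (k%:R * s)) = q - q ^+ p.+1.
  elim: p => [|p IH]; first by rewrite big_geq// mulr0 expr1 subrr.
  by rewrite big_nat_recr//= mulrDr IH qE !exprS; ring.
(* The empty range [m = 0] is separate: the telescoped form would give [q - 1] instead of 0. *)
case: m => [|m].
  by rewrite big_geq// mulr_ge0 ?(ltW q0)// addr_ge0 ?invr_ge0 ?(ltW s0).
have q1 : 0 < 1 - q by have := mulr_gt0 s0 q0; lra.
rewrite -(ler_pM2l q1) telescope.
have sV : s * s^-1 = 1 by rewrite divff// gt_eqF.
have sV0 : 0 < s^-1 by rewrite invr_gt0.
have /ltW qm : 0 < q ^+ m.+1 by exact: exprn_gt0.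
(* After multiplication by [s] this is [qs], that is [e ^ s >= 1 + s]. *)
have : 1 <= (1 - q) * (1 + s^-1).
  rewrite -(ler_pM2l s0) [X in _ <= X](_ : _ = (1 - q) * (s + s * s^-1)); last ring.
  by rewrite sV; lra.
move=> h; have := ler_wpM2r (ltW q0) h; lra.
Qed.

Lemma norm_heat_dirichlet_le (R : realType) (j : nat -> nat) (i : nat) (t a b : R) :
  (0 < Jprod j i)%N -> 0 < t ->
  `|heat_dirichlet (Len R j i) t a b| <=
  (Jprod j i)%:R * (1 + ((Jprod j i)%:R ^+ 2 * t)^-1) * expR (- ((Jprod j i)%:R ^+ 2 * t)).
Proof.
move=> J0 t0; set J : R := (Jprod j i)%:R; set s := J ^+ 2 * t.
have JR0 : 0 < J by rewrite ltr0n.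
have p0 := pi_gt0 R; have p2 := pi_ge2 R.
have s0 : 0 < s by rewrite mulr_gt0// exprn_gt0.
have LE : 2 / Len R j i = 2 / pi * J by rewrite /Len -/J invf_div mulrAC mulrA.
have pr0 : 0 <= 2 / Len R j i by rewrite LE !mulr_ge0 ?invr_ge0 ?(ltW p0) ?(ltW JR0).
(* The prefactor is [(2 / pi) * J], and [pi >= 2]. *)
have prJ : 2 / Len R j i <= J.
  by rewrite LE ler_piMl ?(ltW JR0)// ler_pdivrMr// mul1r.
rewrite /heat_dirichlet normrM -mulrA (ger0_norm pr0) ler_pM//.
(* Termwise comparison with the geometric series: both sines have norm at most 1, and
   [k <= k ^ 2]. *)
apply: norm_lim_sum_le => m; apply: (le_trans _ (sum_expR_le _ _ m s0)).
apply: ler_sum => k _; rewrite -mulrA normrM (ger0_norm (expR_ge0 _)).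
have expE : k%:R ^+ 2 * pi ^+ 2 * t / (Len R j i) ^+ 2 = k%:R ^+ 2 * s.
  rewrite /Len -/J /s; move: (@pi R) p0 => p p_gt0; field.
  by rewrite !gt_eqF.
rewrite expE -[leRHS]mulr1 ler_pM ?expR_ge0//.
  rewrite ler_expR lerN2 ler_wpM2r ?(ltW s0)// -natrX ler_nat.
  by rewrite -mulnn; case: k {expE} => // k; rewrite leq_pmulr.
by rewrite normrM mulr_ile1 ?sin_max.
Qed.

Lemma norm_coef_le (R : realType) (j n : nat -> nat) (k : nat)
    (x y : Flevel R j n k.+1) :
  (1 < n k.+1)%N -> `|coef x y| <= (n k.+1)%:R.
Proof.
move=> n1; have : 2 <= (n k.+1)%:R :> R by rewrite ler_nat.
by rewrite /coef ler_norml; case: ifP => _; [|case: ifP => _]; lra.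
Qed.

Theorem corollary3p3 (R : realType) (j n : nat -> nat)
    (j0 : j 0%N = 1%N) (n0 : n 0%N = 1%N)
    (jge2 : forall l : nat, (1 <= l)%N -> (2 <= j l)%N)
    (nge2 : forall l : nat, (1 <= l)%N -> (2 <= n l)%N)
    (i : nat) (hi : (1 <= i)%N) (t : R) (ht : 0 < t) (x y : Finf R j n) :
  `| heat t (Phi i x) (Phi i y) - heat t (Phi i.-1 x) (Phi i.-1 y) |
  <= (Nprod n i)%:R * (Jprod j i)%:R
     * (1 + ((Jprod j i)%:R ^+ 2 * t)^-1) * expR (- ((Jprod j i)%:R ^+ 2 * t)).
Proof.
case: i hi => // k _ /=.
(* Coherence of the points of the inverse limit makes the level [k] kernels cancel, leaving only the
   Dirichlet term. *)
have PhiE (z : Finf R j n) : phi (Phi k.+1 z) = Phi k z by exact: (svalP z k).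
have Jpos : (0 < Jprod j k.+1)%N.
  by rewrite /Jprod big_nat; apply: prodn_cond_gt0 => l /andP[l1 _]; exact/ltnW/jge2.
rewrite !PhiE addrAC subrr add0r normrM [X in X * _]normrM normr_nat.
(* The factor [n k.+1] absorbs [coef]; [Nprod n k] is already in the recursion. *)
have -> : Nprod n k.+1 = (n k.+1 * Nprod n k)%N by rewrite /Nprod big_nat_recr//= mulnC.
rewrite natrM -(mulrA _ _%:R (1 + _)) -(mulrA (_ * _) _ (expR _)).
rewrite ler_pM ?mulr_ge0//; last exact: norm_heat_dirichlet_le.
by rewrite ler_wpM2r//; apply: norm_coef_le; exact: nge2.
Qed.
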